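(* Consider an offline contextual bandit with finite context set $\mathcal S$, finite action set $\mathcal A$, mean reward $r:\mathcal S\times\mathcal A\to[0,1]$, context distribution $\rho\in\Delta(\mathcal S)$ and reference policy $\pi^{\mathrm{ref}}\in\Delta(\mathcal A\mid\mathcal S)$ with $\pi^{\mathrm{ref}}(a|s)>0$ for all $(s,a)$. Let $\eta>0$ and $\delta\in(0,1)$. Let $\hat\pi$ be the output of the tabular pessimistic algorithm described in the context. Then for all sufficiently small $\epsilon\in(0,1)$, a number of samples $n=\tilde O\big(\eta\,(C^{\pi^*})^2\,|\mathcal S|\,|\mathcal A|\,\epsilon^{-1}\big)$ suffices to guarantee that, with probability at least $1-\delta$, $\mathrm{SubOpt}(\hat\pi)\le\epsilon$. Here $\tilde O(\cdot)$ hides absolute constants and logarithmic factors (in particular factors polylogarithmic in $|\mathcal S||\mathcal A|/\delta$).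
   Context: Data: an i.i.d. dataset $\mathcal D=\{(s_i,a_i,r_i)\}_{i=1}^n$ with $s_i\sim\rho$, $a_i\sim\pi^{\mathrm{ref}}(\cdot|s_i)$, $r_i=r(s_i,a_i)+\varepsilon_i$, where the $\varepsilon_i$ are i.i.d. mean-zero $1$-subgaussian noises. For a function $f:\mathcal S\times\mathcal A\to\mathbb R$ and a policy $\pi\in\Delta(\mathcal A|\mathcal S)$ define the forward-KL-regularized objective $J(\pi;f)=\mathbb E_{s\sim\rho}\big[\sum_{a}f(s,a)\pi(a|s)-\eta^{-1}\mathrm{KL}(\pi^{\mathrm{ref}}(\cdot|s)\,\|\,\pi(\cdot|s))\big]$, where $\mathrm{KL}(P\|Q)=\sum_a P(a)\log(P(a)/Q(a))$ (equal to $+\infty$ if $Q(a)=0<P(a)$ for some $a$). Let $\pi^*$ be the (unique) maximizer of $J(\cdot;r)$ over $\Delta(\mathcal A|\mathcal S)$ and $\mathrm{SubOpt}(\pi)=J(\pi^*;r)-J(\pi;r)$. The single-policy concentrability is $C^{\pi^*}=\sup_{s,a}\pi^*(a|s)/\pi^{\mathrm{ref}}(a|s)$. Algorithm: let $N(s,a)=\sum_{i=1}^n\mathbf 1\{(s_i,a_i)=(s,a)\}$. If $N(s,a)=0$, set $\bar f(s,a)=0$ and $b(s,a)=1$; otherwise set $\bar f(s,a)=\frac{1}{N(s,a)}\sum_{i}r_i\mathbf 1\{(s_i,a_i)=(s,a)\}$ and $b(s,a)=\sqrt{4\log(2|\mathcal S||\mathcal A|/\delta)/N(s,a)}$. Set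 the pessimistic reward $\hat f=\bar f-b$ and output $\hat\pi=\arg\max_{\pi}J(\pi;\hat f)$. *)

(* Defs.v *)
From HB Require Import structures.
From mathcomp Require Import all_boot all_order all_algebra.
From mathcomp Require Import all_classical all_reals all_analysis.
Set Implicit Arguments. Unset Strict Implicit. Unset Printing Implicit Defensive.
Import Order.TTheory GRing.Theory Num.Theory.
Local Open Scope classical_set_scope.
Local Open Scope ring_scope.

Section Bandit.
Variables (R : realType) (S A : finType).

Definition is_dist (rho : S -> R) : Prop :=
  (forall s, 0 <= rho s) /\ \sum_(s : S) rho s = 1.

Definition is_policy (pi : S -> A -> R) : Prop :=
  forall s, (forall a, 0 <= pi s a) /\ \sum_(a : A) pi s a = 1.

Definition KL (p q : A -> R) : \bar R :=
  (\sum_(a : A)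
     (if p a == 0%R then 0%E
      else if q a == 0%R then +oo%E
      else (p a * ln (p a / q a))%:E))%E.

Definition J (rho : S -> R) (piref : S -> A -> R) (eta : R)
    (pi : S -> A -> R) (f : S -> A -> R) : \bar R :=
  (\sum_(s : S) (rho s)%:E *
     ((\sum_(a : A) f s a * pi s a)%:E - (eta^-1)%:E * KL (piref s) (pi s)))%E.

Definition is_maximizer rho piref eta (f : S -> A -> R) (pi : S -> A -> R) : Prop :=
  is_policy pi /\
  forall pi', is_policy pi' -> (J rho piref eta pi' f <= J rho piref eta pi f)%E.

Definition SubOpt rho piref eta (r : S -> A -> R) (pistar pi : S -> A -> R) : \bar R :=
  (J rho piref eta pistar r - J rho piref eta pi r)%E.

Definition concentrability (pistar piref : S -> A -> R) : R :=
  \big[Num.max/0]_(sa : S * A) (pistar sa.1 sa.2 / piref sa.1 sa.2).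

(* A dataset of n samples ((s_i, a_i), r_i). *)
Definition count n (D : 'I_n -> (S * A) * R) (s : S) (a : A) : nat :=
  #|[set i : 'I_n | (D i).1 == (s, a)]|.

Definition fbar n (D : 'I_n -> (S * A) * R) (s : S) (a : A) : R :=
  if count D s a == 0%N then 0
  else (\sum_(i < n | (D i).1 == (s, a)) (D i).2) / (count D s a)%:R.

Definition bonus (delta : R) n (D : 'I_n -> (S * A) * R) (s : S) (a : A) : R :=
  if count D s a == 0%N then 1
  else Num.sqrt (4 * ln (2 * (#|S| * #|A|)%:R / delta) / (count D s a)%:R).

Definition fhat (delta : R) n (D : 'I_n -> (S * A) * R) (s : S) (a : A) : R :=
  fbar D s a - bonus delta D s a.

End Bandit.

Section Prob.
Variables (R : realType) (S A : finType) (d : measure_display) (T : measurableType d)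
  (P : probability T R).
Local Open Scope ereal_scope.

(* Mutual independence of the 2n random elements (s_i,a_i) (i < n) and eps_i (i < n):
   product rule for every choice of (measurable) sets; choosing full sets
   recovers every sub-family. Every subset of the finite type S * A is measurable. *)
Definition mutually_independent n (X : 'I_n -> T -> S * A) (E : 'I_n -> T -> R) : Prop :=
  forall (B : 'I_n -> set (S * A)) (C : 'I_n -> set R),
    (forall i, measurable (C i)) ->
    P (\bigcap_i (X i @^-1` B i `&` E i @^-1` C i)) =
    \prod_(i < n) (P (X i @^-1` B i) * P (E i @^-1` C i)).

Definition subgaussian1 (eps : T -> R) : Prop :=
  measurable_fun setT eps /\
  P.-integrable setT (EFin \o eps) /\
  'E_P[eps] = 0 /\
  forall l : R, 'E_P[fun w => expR (l * eps w)] <= (expR (l ^+ 2 / 2))%:E.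

(* The offline data-generating model: i.i.d. triples with s_i ~ rho,
   a_i ~ piref(.|s_i), r_i = r(s_i,a_i) + eps_i, eps_i i.i.d. mean-zero 1-subgaussian. *)
Definition offline_data_model n (rho : S -> R) (piref : S -> A -> R)
    (X : 'I_n -> T -> S * A) (E : 'I_n -> T -> R) : Prop :=
  (forall i x, measurable (X i @^-1` [set x])) /\
  (forall i s a, P (X i @^-1` [set (s, a)]) = (rho s * piref s a)%:E) /\
  (forall i, subgaussian1 (E i)) /\
  (forall i j (C : set R), measurable C -> P (E i @^-1` C) = P (E j @^-1` C)) /\
  mutually_independent X E.

Definition dataset n (r : S -> A -> R) (X : 'I_n -> T -> S * A) (E : 'I_n -> T -> R)
    (w : T) : 'I_n -> (S * A) * R :=
  fun i => (X i w, (r (X i w).1 (X i w).2 + E i w)%R).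

End Prob.

(* Main.v *)
(** Fix a state and write [p], [u], [v] for the reference policy, the optimal
policy of [r] and the optimal policy of the pessimistic reward [f].  The
first-order condition for [v], together with
[x - 1 - ln x >= (x - 1)^2 / (2 (x + 1))] at [x = u / v], bounds the gap by
[sum (r - f)(u - v) - eta^-1 sum p (u - v)^2 / (2 v (u + v))].  As the gap is
nonnegative, [v <= 2 u] once [f] is uniformly close to [r], which is where a
small [eps] is needed; then AM-GM gives a gap of at most
[3 eta sum (u / p)^2 p (f - r)^2 <= 3 eta C^2 sum p (f - r)^2].

For the sampling error, condition on the covariates [X = x]: independence
gives the moment generating function of the noise on this event, hence a
Chernoff bound, while the visit counts are binomial and reach a quarter of
their means.  So [rho p (f - r)^2 <= 64 L / n] for every pair with
probability at least [1 - delta], and summing over the pairs gives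
[192 eta C^2 |S| |A| L / n <= eps]. *)

Require Import Defs.
From HB Require Import structures.
From mathcomp Require Import all_boot all_order all_algebra.
From mathcomp Require Import ring lra.
From mathcomp Require Import all_classical all_reals all_analysis.
From mathcomp Require Import measurable_realfun.
Set Implicit Arguments. Unset Strict Implicit. Unset Printing Implicit Defensive.
Import Order.TTheory GRing.Theory Num.Theory.
Local Open Scope classical_set_scope.
Local Open Scope ring_scope.

(** * The regularized objective at one state *)

Lemma ln_ge1V (R : realType) (y : R) : 0 < y -> 1 - y^-1 <= ln y.
Proof.
move=> y0; have yV0 : 0 < y^-1 by rewrite invr_gt0.
have : ln (1 + (y^-1 - 1)) <= y^-1 - 1 by apply: le_ln1Dx; lra.
by rewrite addrC subrK lnV ?posrE//; lra.
Qed.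

(* Obtained by applying [ln y <= y - 1] at [y = sqrt x]. *)
Lemma ln_le_quadratic (R : realType) (x : R) : 0 < x ->
  ln x <= x - 1 - (x - 1) ^+ 2 / (2 * (x + 1)).
Proof.
move=> x0; set y := Num.sqrt x.
have y0 : 0 < y by rewrite sqrtr_gt0.
have xy : x = y ^+ 2 by rewrite sqr_sqrtr// ltW.
have ly : ln y <= y - 1.
  by have := @le_ln1Dx R (y - 1); rewrite (addrC 1) subrK; apply; lra.
have -> : ln x = ln y *+ 2 by rewrite xy lnXn.
have h : (x - 1) ^+ 2 / (2 * (x + 1)) <= (y - 1) ^+ 2.
  rewrite ler_pdivrMr; last by lra.
  rewrite xy -subr_ge0.
  have -> : (y - 1) ^+ 2 * (2 * (y ^+ 2 + 1)) - (y ^+ 2 - 1) ^+ 2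
    = ((y - 1) ^+ 2) ^+ 2 by ring.
  exact: sqr_ge0.
rewrite mulr2n; move: h; rewrite xy; nra.
Qed.

(** This is the passage [t -> 0] without limits: if [a > 0], then [t = a / (2 * (a + b))] is
    admissible and gives [t * b <= a / 2]. *)
Lemma le0_of_le_small_mul (R : realFieldType) (a b : R) : 0 <= b ->
  (forall t, 0 < t -> t <= 1 / 2 -> a <= t * b) -> a <= 0.
Proof.
move=> b0 h; rewrite leNgt; apply/negP => a0.
have ab : 0 < a + b by lra.
pose t := a / (2 * (a + b)).
have tE : t * (2 * (a + b)) = a by rewrite /t divfK//; apply: lt0r_neq0; lra.
have t0 : 0 < t by apply: divr_gt0; lra.
have th : t <= 1 / 2 by rewrite /t ler_pdivrMr; lra.
have := h t t0 th; nra.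
Qed.

Section OneState.
Variables (R : realType) (A : finType).
Implicit Types p u v f r : A -> R.

Definition state_objective p (eta : R) f v : R :=
  \sum_a f a * v a - eta^-1 * \sum_a p a * ln (p a / v a).

Lemma state_objectiveB p eta f u v : (forall a, 0 < p a) ->
  (forall a, 0 < u a) -> (forall a, 0 < v a) ->
  state_objective p eta f u - state_objective p eta f v =
  \sum_a f a * (u a - v a) + eta^-1 * \sum_a p a * ln (u a / v a).
Proof.
move=> p0 u0 v0; rewrite /state_objective.
have -> : \sum_a f a * (u a - v a) = \sum_a f a * u a - \sum_a f a * v a.
  by rewrite -sumrB; apply: eq_bigr => a _; rewrite mulrBr.
have -> : \sum_a p a * ln (u a / v a) =
    \sum_a p a * ln (p a / v a) - \sum_a p a * ln (p a / u a).
  rewrite -sumrB; apply: eq_bigr => a _.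
  by rewrite !ln_div ?posrE//; ring.
ring.
Qed.

(** Only maximality along the segment from [v] to [u] is assumed. The derivative at [t = 0] is
    replaced by the bound [ln (1 + y) >= y - 2 y^2]; dividing by [t] leaves an error of order
    [t]. *)
Lemma first_order_condition p eta f u v : 0 < eta -> (forall a, 0 < p a) ->
  (forall a, 0 < u a) -> (forall a, 0 < v a) ->
  (forall t, 0 < t -> t <= 1 / 2 ->
     state_objective p eta f (fun a => v a + t * (u a - v a)) <=
     state_objective p eta f v) ->
  \sum_a f a * (u a - v a) + eta^-1 * \sum_a p a * ((u a - v a) / v a) <= 0.
Proof.
move=> eta0 p0 u0 v0 hmax.
have etaV0 : 0 < eta^-1 by rewrite invr_gt0.
pose z a := (u a - v a) / v a.
have zv a : z a * v a = u a - v a by rewrite /z divfK ?gt_eqF.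
have z1 a : -1 < z a by rewrite /z ltr_pdivlMr//; have := u0 a; lra.
apply: (@le0_of_le_small_mul _ _ (eta^-1 * \sum_a p a * (2 * z a ^+ 2))).
  apply: mulr_ge0; first exact: ltW.
  apply: sumr_ge0 => a _; apply: mulr_ge0; first exact: ltW.
  by have := sqr_ge0 (z a); lra.
move=> t t0 th; rewrite -(ler_pM2l t0).
have vt0 a : 0 < v a + t * (u a - v a).
  have : 0 < t * u a by exact: mulr_gt0.
  have : 0 < (1 - t) * v a by apply: mulr_gt0 => //; lra.
  by lra.
have := hmax t t0 th; rewrite -(subr_le0 (state_objective _ _ _ v)) state_objectiveB//.
have -> : \sum_a f a * (v a + t * (u a - v a) - v a) =
    t * \sum_a f a * (u a - v a).
  by rewrite mulr_sumr; apply: eq_bigr => a _; ring.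
have : \sum_a p a * (t * z a - 2 * (t * z a) ^+ 2) <=
    \sum_a p a * ln ((v a + t * (u a - v a)) / v a).
  apply: ler_sum => a _; rewrite ler_pM2l//.
  have -> : (v a + t * (u a - v a)) / v a = 1 + t * z a.
    by rewrite /z; field; rewrite gt_eqF.
  (* Here [t <= 1/2] matters: [z > -1] gives [y >= -1/2], which makes the factor [1 + 2 y] below
     nonnegative. *)
  set y := t * z a; have y1 : - (1 / 2) <= y.
    have : 0 < t * (1 + z a) by apply: mulr_gt0 => //; have := z1 a; lra.
    by rewrite /y; lra.
  have y10 : 0 < 1 + y by lra.
  apply: le_trans (ln_ge1V y10); rewrite -subr_ge0.
  have -> : 1 - (1 + y)^-1 - (y - 2 * y ^+ 2) = y ^+ 2 * (1 + 2 * y) / (1 + y).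
    by field; rewrite gt_eqF.
  apply: divr_ge0; last exact: ltW.
  by apply: mulr_ge0; [exact: sqr_ge0|lra].
have -> : \sum_a p a * (t * z a - 2 * (t * z a) ^+ 2) =
    t * \sum_a p a * z a - t ^+ 2 * \sum_a p a * (2 * z a ^+ 2).
  by rewrite !mulr_sumr -sumrB; apply: eq_bigr => a _; ring.
rewrite -(ler_pM2l etaV0) -/(z _).
set F := \sum_a f a * _; set L := \sum_a p a * ln _.
set Q := \sum_a p a * (2 * _); set Z := \sum_a p a * z a.
lra.
Qed.

(** The first-order condition cancels the [f] part of the linear term together with the linear part
    of the logarithm. What remains is the reward error tested against [u - v], minus the curvature
    of the regularizer. *)
Lemma state_gap_le p eta f r u v : 0 < eta -> (forall a, 0 < p a) ->
  (forall a, 0 < u a) -> (forall a, 0 < v a) ->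
  \sum_a f a * (u a - v a) + eta^-1 * \sum_a p a * ((u a - v a) / v a) <= 0 ->
  state_objective p eta r u - state_objective p eta r v <=
  \sum_a (r a - f a) * (u a - v a) -
  eta^-1 * \sum_a p a * ((u a - v a) ^+ 2 / (2 * v a * (u a + v a))).
Proof.
move=> eta0 p0 u0 v0 foc; rewrite state_objectiveB//.
have -> : \sum_a r a * (u a - v a) =
    \sum_a (r a - f a) * (u a - v a) + \sum_a f a * (u a - v a).
  by rewrite -big_split; apply: eq_bigr => a _ /=; ring.
have etaV0 : 0 < eta^-1 by rewrite invr_gt0.
have : \sum_a p a * ln (u a / v a) <= \sum_a p a * ((u a - v a) / v a) -
    \sum_a p a * ((u a - v a) ^+ 2 / (2 * v a * (u a + v a))).
  rewrite -sumrB; apply: ler_sum => a _; rewrite -mulrBr ler_pM2l//.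
  apply: le_trans (ln_le_quadratic (divr_gt0 (u0 a) (v0 a))) _.
  rewrite le_eqVlt; apply/orP; left; apply/eqP.
  have ? : v a != 0 by rewrite gt_eqF.
  have ? : u a + v a != 0 by rewrite gt_eqF// addr_gt0.
  by field; apply/andP.
rewrite -(ler_pM2l etaV0); move: foc.
set F := \sum_a f a * _; set Z := \sum_a p a * (_ / v _).
set D := \sum_a _ * (_ ^+ 2 / _); set G := \sum_a (_ - _) * _.
set X := \sum_a _ * ln _.
lra.
Qed.

(** If [v a > 2 u a] at a single action, the curvature at that action alone outweighs the reward
    error, and the gap would be negative. The error is compared with [p] at every action because the
    offending one is not known in advance. *)
Lemma maximizer_le_double p eta f r u v : 0 < eta -> (forall a, 0 < p a) ->
  (forall a, 0 < u a) -> (forall a, 0 < v a) ->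
  \sum_a u a = 1 -> \sum_a v a = 1 ->
  \sum_a f a * (u a - v a) + eta^-1 * \sum_a p a * ((u a - v a) / v a) <= 0 ->
  state_objective p eta r v <= state_objective p eta r u ->
  (forall a b, 24 * eta * `|f a - r a| <= p b) ->
  forall a, v a <= 2 * u a.
Proof.
move=> eta0 p0 u0 v0 u1 v1 foc le_vu small a; rewrite leNgt; apply/negP => uv.
have etaV0 : 0 < eta^-1 by rewrite invr_gt0.
have := state_gap_le r eta0 p0 u0 v0 foc.
set D := \sum_b p b * _; set G := \sum_b (_ - _) * _ => gap.
(* The error is at most [p a / (24 eta)] and [u], [v] have total mass 2. *)
have G_le : G <= p a / (12 * eta).
  have -> : p a / (12 * eta) = \sum_b (p a / (24 * eta)) * (u b + v b).
    by rewrite -mulr_sumr big_split/= u1 v1; field; rewrite gt_eqF.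
  apply: ler_sum => b _; apply: le_trans (ler_norm _) _; rewrite normrM.
  apply: ler_pM => //.
    rewrite ler_pdivlMr; last by lra.
    by rewrite distrC mulrC small.
  by apply: le_trans (ler_normB _ _) _; rewrite !gtr0_norm.
(* From [v > 2 u] follow [(u - v)^2 > v^2 / 4] and [2 v (u + v) < 3 v^2], hence a ratio above
   [1/12]. *)
have D_gt : p a / 12 < D.
  rewrite /D (bigD1 a)//= -[X in X < _]addr0; apply: ltr_leD.
    rewrite ltr_pM2l// ltr_pdivlMr; last by have := u0 a; have := v0 a; nra.
    by have := u0 a; nra.
  apply: sumr_ge0 => b _; apply: mulr_ge0; first exact: ltW.
  apply: divr_ge0; first exact: sqr_ge0.
  by have := u0 b; have := v0 b; nra.
move: D_gt; rewrite -(ltr_pM2l etaV0) => D_gt.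
have E : p a / (12 * eta) = eta^-1 * (p a / 12) by field; rewrite gt_eqF.
rewrite E in G_le.
lra.
Qed.

Lemma state_gap_quadratic p eta f r u v : 0 < eta -> (forall a, 0 < p a) ->
  (forall a, 0 < u a) -> (forall a, 0 < v a) ->
  \sum_a f a * (u a - v a) + eta^-1 * \sum_a p a * ((u a - v a) / v a) <= 0 ->
  (forall a, v a <= 2 * u a) ->
  state_objective p eta r u - state_objective p eta r v <=
  \sum_a 3 * eta * (u a / p a) ^+ 2 * (p a * (f a - r a) ^+ 2).
Proof.
move=> eta0 p0 u0 v0 foc vu.
apply: le_trans (state_gap_le r eta0 p0 u0 v0 foc) _.
rewrite mulr_sumr -sumrB; apply: ler_sum => a _.
have {}u0 := u0 a; have {}v0 := v0 a; have {}p0 := p0 a; have {}vu := vu a.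
set x := r a - f a; set y := u a - v a.
have K0 : 0 < 2 * eta * v a * (u a + v a).
  by rewrite !mulr_gt0// addr_gt0.
pose K := p a / (2 * eta * v a * (u a + v a)).
have KE : K * (2 * eta * v a * (u a + v a)) = p a.
  by rewrite /K divfK// gt_eqF.
have -> : eta^-1 * (p a * (y ^+ 2 / (2 * v a * (u a + v a)))) = K * y ^+ 2.
  rewrite /K; field; rewrite !gt_eqF// ?addr_gt0//.
have Kp : 0 < K by rewrite divr_gt0.
(* AM-GM: [x y <= K y^2 + x^2 / (4 K)] *)
have amgm : x * y - K * y ^+ 2 <= x ^+ 2 * (eta * v a * (u a + v a) / (2 * p a)).
  have -> : eta * v a * (u a + v a) / (2 * p a) = (4 * K)^-1.
    by rewrite /K; field; rewrite !gt_eqF// ?addr_gt0.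
  rewrite ler_pdivlMr; last by lra.
  have := sqr_ge0 (x - 2 * K * y); nra.
apply: le_trans amgm _.
(* The constant 3 is half of 6, where [v (u + v) <= 2 u * 3 u = 6 u^2]. *)
have -> : 3 * eta * (u a / p a) ^+ 2 * (p a * (f a - r a) ^+ 2) =
    x ^+ 2 * (6 * eta * u a ^+ 2 / (2 * p a)).
  by rewrite /x; field; rewrite gt_eqF.
apply: ler_wpM2l; first exact: sqr_ge0.
rewrite ler_pM2r; last by rewrite invr_gt0; lra.
rewrite -mulrA (mulrC 6) -mulrA ler_pM2l//.
nra.
Qed.

End OneState.

(** * Suboptimality of a maximizer for a perturbed reward *)

Section Objective.
Variables (R : realType) (S A : finType).
Variables (rho : S -> R) (piref : S -> A -> R) (eta : R).
Hypotheses (rho_dist : is_dist rho) (piref_policy : is_policy piref)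
  (piref_gt0 : forall s a, 0 < piref s a) (eta_gt0 : 0 < eta).
Implicit Types f pi : S -> A -> R.

Let rho_gt0 s : rho s != 0 -> 0 < rho s.
Proof. by move=> ?; rewrite lt_neqAle eq_sym rho_dist.1 andbT. Qed.

(** Positivity is asked only where [rho] has mass: elsewhere the product with 0 vanishes even if the
    divergence is infinite. *)
Lemma J_EFin f pi : (forall s a, rho s != 0 -> 0 < pi s a) ->
  J rho piref eta pi f =
  (\sum_s rho s * state_objective (piref s) eta (f s) (pi s))%:E.
Proof.
move=> pi0; rewrite /J -sumEFin; apply: eq_bigr => s _.
have [rs0|rs0] := eqVneq (rho s) 0; first by rewrite rs0 mul0e mul0r.
have -> : KL (piref s) (pi s) = (\sum_a piref s a * ln (piref s a / pi s a))%:E.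
  rewrite /KL -sumEFin; apply: eq_bigr => a _.
  by rewrite !gt_eqF// pi0.
by [].
Qed.

(** A zero at a state with mass makes the divergence infinite and the objective [-oo], whereas
    [piref] itself has a finite objective. *)
Lemma maximizer_gt0 f pi : is_maximizer rho piref eta f pi ->
  forall s a, rho s != 0 -> 0 < pi s a.
Proof.
move=> [pi_policy pi_max] s a rs0.
rewrite lt_neqAle (pi_policy s).1 andbT eq_sym; apply/eqP => pi0.
suff JNy : J rho piref eta pi f = -oo%E.
  by have := pi_max _ piref_policy; rewrite JNy J_EFin.
have KLy : KL (piref s) (pi s) = +oo%E.
  apply/eqP; rewrite /KL esum_eqy; last first.
    by move=> b _; case: ifP => // _; case: ifP.
  by apply/existsP; exists a; rewrite /= (gt_eqF (piref_gt0 s a)) -pi0 !eqxx.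
apply/eqP; rewrite /J esum_eqNy; apply/existsP; exists s => /=.
rewrite KLy gt0_muley ?lte_fin ?invr_gt0//.
by rewrite addeNy gt0_muleNy// lte_fin rho_gt0.
Qed.

(** The objective is a weighted sum over states, so changing the policy at [s] alone isolates one
    summand. *)
Lemma maximizer_state f pi : is_maximizer rho piref eta f pi ->
  forall s w, rho s != 0 -> (forall a, 0 < w a) -> \sum_a w a = 1 ->
  state_objective (piref s) eta (f s) w <=
  state_objective (piref s) eta (f s) (pi s).
Proof.
move=> pi_max s w rs0 w0 w1; have pi0 := maximizer_gt0 pi_max.
case: pi_max => pi_policy pi_max.
pose pi' s' := if s' == s then w else pi s'.
have pi'_policy : is_policy pi'.
  by move=> s'; rewrite /pi'; case: eqP => // _; split => // a; exact: ltW.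
have pi'0 s' a : rho s' != 0 -> 0 < pi' s' a.
  by move=> rs'0; rewrite /pi'; case: eqP => // _; exact: pi0.
have := pi_max _ pi'_policy; rewrite !J_EFin// lee_fin.
rewrite (bigD1 s)//= [X in _ <= X](bigD1 s)//= /pi' eqxx.
under eq_bigr => s' /negbTE -> do [].
by rewrite lerD2r ler_pM2l ?rho_gt0.
Qed.

Lemma maximizer_first_order f pi : is_maximizer rho piref eta f pi ->
  forall s u, rho s != 0 -> (forall a, 0 < u a) -> \sum_a u a = 1 ->
  \sum_a f s a * (u a - pi s a) +
    eta^-1 * \sum_a piref s a * ((u a - pi s a) / pi s a) <= 0.
Proof.
move=> pi_max s u rs0 u0 u1; have pi0 a := maximizer_gt0 pi_max a rs0.
apply: first_order_condition => // t t0 th.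
apply: maximizer_state => //.
  move=> a; have : 0 < t * u a by exact: mulr_gt0.
  have : 0 < (1 - t) * pi s a by apply: mulr_gt0 => //; lra.
  lra.
by rewrite big_split/= -mulr_sumr sumrB u1 (pi_max.1 s).2 subrr mulr0 addr0.
Qed.

(** This is the deterministic half of the argument. Its last two hypotheses are what concentration
    must supply: a uniform closeness that yields [pi <= 2 pistar], and a bound on the squared error
    weighted by the law of the pair. *)
Lemma SubOpt_le r pistar f pi (K : R) :
  is_maximizer rho piref eta r pistar -> is_maximizer rho piref eta f pi ->
  0 <= K ->
  (forall s a b, rho s != 0 -> 24 * eta * `|f s a - r s a| <= piref s b) ->
  (forall s a, rho s != 0 -> rho s * piref s a * (f s a - r s a) ^+ 2 <= K) ->
  (SubOpt rho piref eta r pistar pi <=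
   (3 * eta * concentrability pistar piref ^+ 2 * (#|S| * #|A|)%:R * K)%:E)%E.
Proof.
move=> star_max pi_max K0 small quad.
have star0 := maximizer_gt0 star_max; have pi0 := maximizer_gt0 pi_max.
rewrite /SubOpt !J_EFin// -EFinB lee_fin -sumrB.
set C := concentrability _ _.
have C_ge s a : pistar s a / piref s a <= C.
  exact: (le_bigmax 0 (fun sa : S * A => pistar sa.1 sa.2 / piref sa.1 sa.2) (s, a)).
have -> : 3 * eta * C ^+ 2 * (#|S| * #|A|)%:R * K =
    \sum_(s : S) \sum_(a : A) 3 * eta * C ^+ 2 * K.
  by rewrite !sumr_const -mulrnA mulnC -[RHS]mulr_natr mulrAC.
apply: ler_sum => s _; rewrite -mulrBr.
have [rs0|rs0] := eqVneq (rho s) 0.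
  rewrite rs0 mul0r; apply: sumr_ge0 => a _.
  by rewrite mulr_ge0// mulr_ge0 ?sqr_ge0// mulr_ge0// ltW.
have foc := maximizer_first_order pi_max rs0
  (fun a => star0 s a rs0) (star_max.1 s).2.
have le2 : forall a, pi s a <= 2 * pistar s a.
  apply: (maximizer_le_double (p := piref s) (eta := eta) (f := f s) (r := r s)) => //.
  - by move=> a; exact: star0.
  - by move=> a; exact: pi0.
  - exact: (star_max.1 s).2.
  - exact: (pi_max.1 s).2.
  - apply: (maximizer_state star_max) => //; last exact: (pi_max.1 s).2.
    by move=> a; exact: pi0.
  - by move=> a b; exact: small.
have /(ler_wpM2l (ltW (rho_gt0 rs0))) := state_gap_quadratic
  (r s) eta_gt0 (piref_gt0 s) (fun a => star0 s a rs0)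
  (fun a => pi0 s a rs0) foc le2.
move/le_trans; apply; rewrite mulr_sumr; apply: ler_sum => a _.
rewrite mulrCA [X in _ * X]mulrA; apply: ler_pM; last exact: quad.
- by rewrite mulr_ge0 ?sqr_ge0// mulr_ge0// ltW.
- by rewrite mulr_ge0 ?sqr_ge0// mulr_ge0// ltW ?rho_gt0.
rewrite ler_wpM2l//; first by rewrite mulr_ge0// ltW.
by rewrite lerXn2r ?nnegrE ?divr_ge0 ?(le_trans _ (C_ge s a)) ?divr_ge0// ltW ?star0.
Qed.

End Objective.

(** * Independence and integrals of products *)

Section Independence.
Import HBNNSimple.
Variables (R : realType) (d : measure_display) (T : measurableType d).

(** A product rule known for indicators of [Y] extends to simple functions by linearity over the
    level sets. *)
Lemma ge0_integral_factor_nnsfun (mu : {measure set T -> \bar R}) (F Y : T -> R)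
    (k : \bar R) :
  measurable_fun setT F -> (forall w, 0 <= F w) -> measurable_fun setT Y ->
  (0 <= k)%E ->
  (forall C, measurable C ->
    (\int[mu]_w (F w * \1_C (Y w))%:E = k * \int[mu]_w (\1_C (Y w))%:E)%E) ->
  forall g : {nnsfun R >-> R},
    (\int[mu]_w (F w * g (Y w))%:E = k * \int[mu]_w (g (Y w))%:E)%E.
Proof.
move=> mF F0 mY k0 hC g.
have mC c : measurable (g @^-1` [set c]) by [].
have m1 c : measurable_fun setT (fun w => \1_(g @^-1` [set c]) (Y w) : R).
  by apply: (measurableT_comp (f := \1_(g @^-1` [set c]) : R -> R)).
have gE w : g (Y w) = \sum_(c \in range g) c * \1_(g @^-1` [set c]) (Y w).
  exact: fimfunE.
(* For negative [c] the level set is empty, so the term is 0. *)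
have c0 c w : 0 <= c * \1_(g @^-1` [set c]) (Y w).
  rewrite indicE; have [|] := boolP (Y w \in _); last by rewrite mulr0.
  by rewrite inE /= => <-; rewrite mulr1.
have -> : (\int[mu]_w (F w * g (Y w))%:E =
    \sum_(c \in range g) \int[mu]_w (F w * (c * \1_(g @^-1` [set c]) (Y w)))%:E)%E.
  rewrite -(ge0_integral_fsum mu measurableT
    (f := fun c w => (F w * (c * \1_(g @^-1` [set c]) (Y w)))%:E))//.
  - by apply: eq_integral => w _; rewrite gE fsumEFin// mulr_fsumr.
  - by move=> c; apply/measurable_EFinP/measurable_funM/measurable_funM.
  - by move=> c w _; rewrite lee_fin mulr_ge0.
have -> : (\int[mu]_w (g (Y w))%:E =
    \sum_(c \in range g) \int[mu]_w (c * \1_(g @^-1` [set c]) (Y w))%:E)%E.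
  rewrite -(ge0_integral_fsum mu measurableT
    (f := fun c w => (c * \1_(g @^-1` [set c]) (Y w))%:E))//.
  - by apply: eq_integral => w _; rewrite gE fsumEFin.
  - by move=> c; apply/measurable_EFinP/measurable_funM.
  - by move=> c w _; rewrite lee_fin.
rewrite ge0_mule_fsumr; last by move=> c; apply: integral_ge0 => w _; rewrite lee_fin.
apply: eq_fsbigr => c; rewrite inE => -[y _ gyc].
have {}c0 : 0 <= c by rewrite -gyc.
under eq_integral do rewrite mulrCA EFinM.
under [in RHS]eq_integral do rewrite EFinM.
rewrite (ge0_integralZl_EFin mu measurableT
  (f1 := fun w => (F w * \1_(g @^-1` [set c]) (Y w))%:E))//; last 2 first.
- by move=> w _; rewrite lee_fin mulr_ge0.
- exact/measurable_EFinP/measurable_funM.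
rewrite (ge0_integralZl_EFin mu measurableT
  (f1 := fun w => (\1_(g @^-1` [set c]) (Y w))%:E))//; last exact/measurable_EFinP.
by rewrite hC// muleCA.
Qed.

(** Monotone convergence along simple approximations of [h]; finiteness of [k] lets the factor pass
    through the limit. *)
Lemma ge0_integral_factor (mu : {measure set T -> \bar R}) (F Y : T -> R)
    (k : \bar R) (h : R -> R) :
  measurable_fun setT F -> (forall w, 0 <= F w) -> measurable_fun setT Y ->
  (0 <= k)%E -> k \is a fin_num ->
  (forall C, measurable C ->
    (\int[mu]_w (F w * \1_C (Y w))%:E = k * \int[mu]_w (\1_C (Y w))%:E)%E) ->
  measurable_fun setT h -> (forall y, 0 <= h y) ->
  (\int[mu]_w (F w * h (Y w))%:E = k * \int[mu]_w (h (Y w))%:E)%E.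
Proof.
move=> mF F0 mY k0 kfin hC mh h0.
have mhE : measurable_fun setT (EFin \o h) by exact/measurable_EFinP.
pose g := nnsfun_approx measurableT mhE.
have gY m : measurable_fun setT (fun w => g m (Y w)) by exact: measurableT_comp.
have g_cvg w : (g m (Y w))%:E @[m --> \oo] --> (h (Y w))%:E.
  exact: (cvg_nnsfun_approx measurableT mhE (fun y _ => h0 y) (x := Y w)).
have g_nd w : {homo (fun m => g m (Y w)) : m m' / (m <= m')%N >-> m <= m'}.
  by move=> m m' mm'; have /lefP := nd_nnsfun_approx measurableT mhE mm'; exact.
have F_cvg : (\int[mu]_w (F w * g m (Y w))%:E)%E @[m --> \oo] -->
    (\int[mu]_w (F w * h (Y w))%:E)%E.
  have -> : (\int[mu]_w (F w * h (Y w))%:E)%E =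
      (\int[mu]_w limn (fun m => (F w * g m (Y w))%:E))%E.
    apply: eq_integral => w _; apply/esym/cvg_lim => //.
    under eq_fun do rewrite EFinM.
    by rewrite EFinM; apply: cvgeZl.
  apply: cvg_monotone_convergence => //.
  - by move=> m; apply/measurable_EFinP/measurable_funM.
  - by move=> m w _; rewrite lee_fin mulr_ge0.
  - by move=> w _ m m' mm'; rewrite lee_fin ler_wpM2l// g_nd.
have g_int : (\int[mu]_w (g m (Y w))%:E)%E @[m --> \oo] -->
    (\int[mu]_w (h (Y w))%:E)%E.
  have -> : (\int[mu]_w (h (Y w))%:E)%E =
      (\int[mu]_w limn (fun m => (g m (Y w))%:E))%E.
    by apply: eq_integral => w _; apply/esym/cvg_lim.
  apply: cvg_monotone_convergence => //.
  - by move=> m; exact/measurable_EFinP.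
  - by move=> m w _; rewrite lee_fin.
  - by move=> w _ m m' mm'; rewrite lee_fin g_nd.
apply: (cvg_unique _ F_cvg) => //.
have -> : (fun m => \int[mu]_w (F w * g m (Y w))%:E)%E =
    (fun m => k * \int[mu]_w (g m (Y w))%:E)%E.
  by apply/funext => m; exact: ge0_integral_factor_nnsfun.
exact: cvgeZl.
Qed.


End Independence.

(** * Restriction to a fixed sequence of covariates *)

Section DataModel.
Variables (R : realType) (S A : finType) (d : measure_display)
  (T : measurableType d) (P : probability T R) (n : nat).
Variables (X : 'I_n -> T -> S * A) (E : 'I_n -> T -> R).
Hypotheses (mX : forall i x, measurable (X i @^-1` [set x]))
  (mE : forall i, measurable_fun setT (E i))
  (XE_indep : mutually_independent P X E).
Variable x : 'I_n -> S * A.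

(** Integrating over this event stands in for conditioning on the covariates, so null sequences need
    no separate treatment. *)
Definition cylinder : set T := \bigcap_i (X i @^-1` [set x i]).

Lemma measurable_cylinder : measurable cylinder.
Proof. by apply: fin_bigcap_measurable => // i _; exact: mX. Qed.

Lemma integral_cylinder_indic (C : 'I_n -> set R) : (forall i, measurable (C i)) ->
  (\int[P]_w (\1_cylinder w * \prod_i \1_(C i) (E i w))%:E =
   \prod_i (P (X i @^-1` [set x i]) * \int[P]_w (\1_(C i) (E i w))%:E))%E.
Proof.
move=> mC.
have indE i w : \1_(C i) (E i w) = \1_(E i @^-1` C i) w :> R by rewrite !indicE.
have mEC i : measurable (E i @^-1` C i).
  by rewrite -[X in measurable X]setTI; exact: mE.
under [in RHS]eq_bigr do under eq_integral do rewrite indE.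
under [in RHS]eq_bigr do rewrite integral_indic// setIT.
rewrite -XE_indep// -[in RHS](setIT (\bigcap_i _)) -integral_indic//; last first.
  by apply: fin_bigcap_measurable => // i _; exact: measurableI.
apply: eq_integral => w _; congr EFin; rewrite bigcapI indicI/=; congr (_ * _).
rewrite [RHS]indicE; have [|] := boolP (w \in _).
  rewrite inE => wC; rewrite big1// => i _; rewrite indE indicE mem_set//.
  exact: wC.
move=> /negP wC; apply/eqP; rewrite prodf_seq_eq0.
apply: contra_notT wC => /hasPn all1; rewrite inE => i _.
have := all1 i (mem_index_enum _); rewrite /= indE indicE.
by have [|] := boolP (w \in _); rewrite ?inE// eqxx.
Qed.

Lemma integral_cylinder_prod (h : 'I_n -> R -> R) :
  (forall i, measurable_fun setT (h i)) -> (forall i y, 0 <= h i y) ->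
  (forall i, (\int[P]_w (h i (E i w))%:E < +oo)%E) ->
  (\int[P]_w (\1_cylinder w * \prod_i h i (E i w))%:E =
   \prod_i (P (X i @^-1` [set x i]) * \int[P]_w (h i (E i w))%:E))%E.
Proof.
(* The indicators are replaced one at a time by the functions [h i]. *)
suff main m : forall h : 'I_n -> R -> R,
    (forall i, measurable_fun setT (h i)) -> (forall i y, 0 <= h i y) ->
    (forall i, (\int[P]_w (h i (E i w))%:E < +oo)%E) ->
    (forall i : 'I_n, (m <= i)%N -> exists2 C, measurable C & h i = \1_C) ->
    (\int[P]_w (\1_cylinder w * \prod_i h i (E i w))%:E =
     \prod_i (P (X i @^-1` [set x i]) * \int[P]_w (h i (E i w))%:E))%E.
  move=> mh h0 hfin; apply: (main n) => // i.
  by rewrite leqNgt ltn_ord.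
elim: m => [|m IHm] {}h mh h0 hfin hind.
  have /choice[C hC] : forall i, exists C, measurable C /\ h i = \1_C.
    by move=> i; have [C] := hind i isT; exists C.
  have -> : h = fun i => \1_(C i) by apply/funext => i; exact: (hC i).2.
  by apply: integral_cylinder_indic => i; exact: (hC i).1.
have [nm|mn] := leqP n m.
  by apply: IHm => // i /(leq_trans nm); rewrite leqNgt ltn_ord.
pose j := Ordinal mn.
(* [F] and [k] gather all that does not involve [E j], on the left and on the right. *)
pose F w := \1_cylinder w * \prod_(i | i != j) h i (E i w).
pose k := (P (X j @^-1` [set x j]) *
  \prod_(i | i != j) (P (X i @^-1` [set x i]) * \int[P]_w (h i (E i w))%:E))%E.
have int_ge0 i : (0 <= \int[P]_w (h i (E i w))%:E)%E.
  by apply: integral_ge0 => w _; rewrite lee_fin.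
have prod_ge0 : (0 <= \prod_(i | i != j)
    (P (X i @^-1` [set x i]) * \int[P]_w (h i (E i w))%:E))%E.
  by apply: prode_ge0 => i _; rewrite mule_ge0.
transitivity (\int[P]_w (F w * h j (E j w))%:E)%E.
  apply: eq_integral => w _; rewrite /F (bigD1 j)//=; congr EFin; ring.
rewrite (bigD1 j)//= muleAC -/k.
apply: ge0_integral_factor => //.
- apply: measurable_funM; first exact: measurable_indic measurable_cylinder.
  under eq_fun do rewrite big_mkcond.
  apply: measurable_prod => i _; have [_|_] := boolP (i != j) => //.
  exact: measurableT_comp.
- by move=> w; apply: mulr_ge0 => //; apply: prodr_ge0.
- by rewrite mule_ge0.
- rewrite fin_numM ?fin_num_measure//; apply: prode_fin_num => i _.
  by rewrite fin_numM ?fin_num_measure// ge0_fin_numE.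
(* Testing against an indicator at [j] is the induction hypothesis for [h] with its [j]-th entry
   replaced by that indicator. *)
move=> C mC; pose h' i := if i == j then \1_C else h i.
have h'j : h' j = \1_C by rewrite /h' eqxx.
have h'E i : i != j -> h' i = h i by rewrite /h' => /negbTE ->.
transitivity (\int[P]_w (\1_cylinder w * \prod_i h' i (E i w))%:E)%E.
  apply: eq_integral => w _; congr EFin; rewrite (bigD1 j)//= h'j /F.
  by under [in RHS]eq_bigr => i /h'E -> do []; ring.
rewrite IHm.
- rewrite (bigD1 j)//= h'j /k muleAC.
  by under [in LHS]eq_bigr => i /h'E -> do [].
- by move=> i; rewrite /h'; case: ifP.
- by move=> i y; rewrite /h'; case: ifP.
- move=> i; rewrite /h'; case: ifP => // _.
  have indE w : \1_C (E i w) = \1_(E i @^-1` C) w :> R by rewrite !indicE.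
  have mEC : measurable (E i @^-1` C).
    by rewrite -[X in measurable X]setTI; exact: mE.
  under eq_integral do rewrite indE.
  by rewrite integral_indic// setIT ltey_eq fin_num_measure.
- move=> i mi; have [->|ij] := eqVneq i j; first by exists C.
  rewrite h'E//; apply: hind.
  by rewrite ltn_neqAle mi andbT; apply: contra ij => /eqP e; apply/eqP/val_inj.
Qed.

End DataModel.

(** * Concentration of the data *)

Lemma measurable_gt_set (R : realType) (d : measure_display)
    (T : measurableType d) (c : R) (f : T -> R) :
  measurable_fun setT f -> measurable [set w | c < f w].
Proof.
move=> mf; rewrite -[X in measurable X]setTI.
apply: (measurable_lte measurableT (f := cst c%:E) (g := EFin \o f)) => //.
exact/measurable_EFinP.
Qed.

Lemma lee_prod (R : realDomainType) (I : finType) (f g : I -> \bar R) :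
  (forall i, (0 <= f i <= g i)%E) -> (\prod_i f i <= \prod_i g i)%E.
Proof.
move=> fg; suff /andP[] : (0 <= \prod_i f i <= \prod_i g i)%E by [].
apply: (big_ind2 (fun a b => (0 <= a <= b)%E)) => [|a b a' b'|i _] //.
  by rewrite lexx lee_fin ler01.
by move=> /andP[a0 ab] /andP[a'0 ab']; rewrite mule_ge0//= lee_pmul.
Qed.

(** * Noise tails at fixed covariates *)

Section Tail.
Variables (R : realType) (S A : finType) (d : measure_display)
  (T : measurableType d) (P : probability T R) (n : nat).
Variables (X : 'I_n -> T -> S * A) (E : 'I_n -> T -> R) (q : S * A -> R).
Hypotheses (mX : forall i x, measurable (X i @^-1` [set x]))
  (Xq : forall i z, P (X i @^-1` [set z]) = (q z)%:E)
  (E_subg : forall i, subgaussian1 P (E i))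
  (XE_indep : mutually_independent P X E).
Variable x : 'I_n -> S * A.

Let mE i : measurable_fun setT (E i). Proof. by case: (E_subg i). Qed.

Let q_ge0 i : 0 <= q (x i).
Proof. by rewrite -lee_fin -(Xq i) measure_ge0. Qed.

Lemma P_cylinder : P (cylinder X x) = (\prod_i q (x i))%:E.
Proof.
have := @integral_cylinder_indic _ _ _ _ _ P _ X E mX mE XE_indep x (fun=> setT)
  (fun=> measurableT).
under eq_integral do under eq_bigr do rewrite indicT.
under eq_integral do rewrite big1_eq mulr1.
rewrite integral_indic// ?setIT; last exact: measurable_cylinder.
move=> ->; rewrite -prodEFin; apply: eq_bigr => i _.
rewrite (eq_integral (cst 1%E)) => [|w _]; last by rewrite indicT.
rewrite integral_cst// mul1e.
rewrite [X in (_ * X)%E](_ : _ = 1%E) ?mule1 ?Xq//.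
exact: probability_setT.
Qed.

Lemma integral_exp_le (l : 'I_n -> R) :
  (\int[P]_w (\1_(cylinder X x) w * \prod_i expR (l i * E i w))%:E <=
   (\prod_i (q (x i) * expR (l i ^+ 2 / 2)))%:E)%E.
Proof.
have mexp i : measurable_fun setT (fun y : R => expR (l i * y)).
  by apply: measurableT_comp => //; exact: measurable_funM.
have int_le i : (\int[P]_w (expR (l i * E i w))%:E <= (expR (l i ^+ 2 / 2))%:E)%E.
  by have [_ [_ [_ /(_ (l i))]]] := E_subg i; rewrite unlock.
rewrite (integral_cylinder_prod mX mE XE_indep x (h := fun i y => expR (l i * y)))//.
- rewrite -prodEFin; apply: lee_prod => i; apply/andP; split.
    by rewrite mule_ge0// integral_ge0// => w _; rewrite lee_fin expR_ge0.
  by rewrite EFinM -(Xq i) lee_wpmul2l.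
- by move=> i; rewrite (le_lt_trans (int_le i)) ?ltry.
Qed.

Lemma measurable_sumE (I : {pred 'I_n}) :
  measurable_fun setT (fun w => \sum_(i in I) E i w).
Proof.
under eq_fun do rewrite big_mkcond.
by apply: measurable_sum => i; have [_|_] := boolP (i \in I).
Qed.

(** Chernoff bound with exponent [t], which is optimal for the threshold [N t], [N] being the size
    of [I]; the sign [sg] covers both tails. The weight of the cylinder is kept as a factor, to be
    summed over [x] later. *)
Lemma tail_one_sided (I : {pred 'I_n}) (t sg : R) : 0 <= t -> sg ^+ 2 = 1 ->
  (P (cylinder X x `&` [set w | (#|I|%:R * t < sg * \sum_(i in I) E i w)%R]) <=
   (\prod_i q (x i) * expR (- (#|I|%:R * t ^+ 2 / 2)))%:E)%E.
Proof.
move=> t0 sg1; set B := [set w | _].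
have mcyl := measurable_cylinder mX x.
have mB : measurable B.
  apply: measurable_gt_set.
  by apply: measurable_funM => //; exact: measurable_sumE.
(* A zero exponent turns the factors outside [I] into 1. *)
pose l i : R := if i \in I then sg * t else 0.
have prodE w : \prod_i expR (l i * E i w) = expR (t * (sg * \sum_(i in I) E i w)).
  rewrite -expR_sum; congr expR; rewrite mulrA mulr_sumr [RHS]big_mkcond/=.
  by apply: eq_bigr => i _; rewrite /l; case: ifP => _; [ring|rewrite mul0r].
have prodl : \prod_i expR (l i ^+ 2 / 2) = expR (#|I|%:R * t ^+ 2 / 2).
  rewrite -expR_sum; congr expR.
  transitivity (\sum_(i in I) t ^+ 2 / 2).
    rewrite [RHS]big_mkcond/=; apply: eq_bigr => i _; rewrite /l.
    by case: ifP => _; rewrite ?exprMn ?sg1 ?expr0n ?mul1r ?mul0r.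
  by rewrite sumr_const -[LHS]mulr_natl mulrA.
rewrite -[_ `&` _]setIT -integral_indic//; last exact: measurableI.
pose c := expR (- (#|I|%:R * t ^+ 2)).
apply: (@le_trans _ _ (\int[P]_w (c%:E * (\1_(cylinder X x) w *
    \prod_i expR (l i * E i w))%:E))%E).
  apply: ge0_le_integral => //.
  - exact/measurable_EFinP/measurable_indic/measurableI.
  - apply: measurable_funeM; apply/measurable_EFinP/measurable_funM => //.
    apply: measurable_prod => i _; apply: measurableT_comp => //.
    exact: measurable_funM.
  - move=> w _; rewrite -EFinM lee_fin indicI /=.
    rewrite !(indicE _ (cylinder X x)).
    have [wc|wc] := boolP (w \in cylinder X x); last by rewrite !mul0r mulr0.
    rewrite !mul1r prodE /c -expRD indicE.
    have [|] := boolP (w \in B); last by rewrite expR_ge0.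
    rewrite inE /B/= => wB; rewrite -[1%:R]expR0 ler_expR.
    have : t * (#|I|%:R * t) <= t * (sg * \sum_(i in I) E i w).
      by rewrite ler_wpM2l// ltW.
    by lra.
rewrite (ge0_integralZl_EFin P measurableT (f1 := fun w =>
  (\1_(cylinder X x) w * \prod_i expR (l i * E i w))%:E)) ?expR_ge0//; last 2 first.
- move=> w _; rewrite lee_fin mulr_ge0// prodr_ge0// => i _; exact: expR_ge0.
- apply/measurable_EFinP/measurable_funM => //.
  apply: measurable_prod => i _; apply: measurableT_comp => //.
  exact: measurable_funM.
apply: (@le_trans _ _ (c%:E * (\prod_i (q (x i) * expR (l i ^+ 2 / 2)))%:E)%E).
  by rewrite lee_wpmul2l ?lee_fin ?expR_ge0//; exact: integral_exp_le.
rewrite -EFinM lee_fin big_split/= prodl /c mulrCA -expRD.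
by rewrite ler_wpM2l ?prodr_ge0// ler_expR; lra.
Qed.

Lemma tail_two_sided (I : {pred 'I_n}) (t : R) : 0 <= t ->
  (P (cylinder X x `&` [set w | (#|I|%:R * t < `|\sum_(i in I) E i w|)%R]) <=
   (\prod_i q (x i) * (2 * expR (- (#|I|%:R * t ^+ 2 / 2))))%:E)%E.
Proof.
move=> t0; pose B sg := cylinder X x `&`
  [set w | (#|I|%:R * t < sg * \sum_(i in I) E i w)%R].
have mcyl := measurable_cylinder mX x.
have mB sg : measurable (B sg).
  apply: measurableI => //; apply: measurable_gt_set.
  by apply: measurable_funM => //; exact: measurable_sumE.
apply: (@le_trans _ _ (P (B 1 `|` B (-1)))).
  apply: le_measure; rewrite ?inE.
  - apply: measurableI => //; apply: measurable_gt_set.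
    by apply: measurableT_comp => //; exact: measurable_sumE.
  - exact: measurableU.
  - move=> w [wc] /=; rewrite ltr_normr => /orP[h|h]; [left|right]; split => //=.
      by rewrite mul1r.
    by rewrite mulN1r.
apply: le_trans (measureU2 _ (mB _) (mB _)) _.
apply: le_trans (leeD (tail_one_sided _ t0 _) (tail_one_sided _ t0 _)) _.
- by rewrite expr1n.
- by rewrite sqrrN expr1n.
by rewrite -EFinD lee_fin; lra.
Qed.

End Tail.

Lemma measure_bigU_le (R : realType) (d : measure_display) (T : measurableType d)
    (mu : {measure set T -> \bar R}) (I : finType) (B : I -> set T) :
  (forall i, measurable (B i)) ->
  (mu (\big[setU/set0]_i B i) <= \sum_i mu (B i))%E.
Proof.
move=> mB; apply: (big_ind2 (fun a b => measurable a /\ (mu a <= b)%E) _ _ _).2.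
- by rewrite measure0.
- move=> a b a' b' [ma ab] [ma' ab']; split; first exact: measurableU.
  exact: le_trans (measureU2 _ ma ma') (leeD ab ab').
- by [].
Qed.

Lemma sum_prod_ffun_eq1 (R : realFieldType) (Z : finType) (q : Z -> R) (n : nat) :
  \sum_z q z = 1 -> \sum_(x : {ffun 'I_n -> Z}) \prod_i q (x i) = 1.
Proof.
by move=> q1; rewrite -(bigA_distr_bigA (fun=> q)) big1.
Qed.

(* Chernoff: [1{4 N < c} <= exp (c / 4 - N)], and the moment generating function
   of the binomial variable [N] at [-1] is at most [exp (- n q / 2)]. *)
Lemma binomial_lower_tail (R : realType) (Z : finType) (q : Z -> R) (n : nat) (z : Z) :
  (forall y, 0 <= q y) -> \sum_y q y = 1 ->
  \sum_(x : {ffun 'I_n -> Z}) \prod_i q (x i) *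
    (4 * #|[pred i | x i == z]|%:R < n%:R * q z)%R%:R
  <= expR (- (n%:R * q z / 4)).
Proof.
move=> q0 q1; pose h y : R := expR (- (y == z)%:R).
have e2 : expR (- 1) <= (1 / 2 : R).
  rewrite expRN div1r lef_pV2 ?posrE ?expR_gt0//.
  by have := @expR_ge1Dx R 1; lra.
have mgf : \sum_y q y * h y <= expR (- (q z / 2)).
  have -> : \sum_y q y * h y = 1 - q z * (1 - expR (- 1)).
    move: (q1); rewrite !(bigD1 z (P := predT))//= /h eqxx.
    rewrite [X in _ -> _ + X = _](eq_bigr q) => [|y /negbTE ->]; first by lra.
    by rewrite oppr0 expR0 mulr1.
  apply: le_trans (expR_ge1Dx _); have := q0 z; nra.
(* The threshold contributes [n q / 4] and the generating function [- n q / 2]. *)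
have -> : expR (- (n%:R * q z / 4)) = expR (n%:R * q z / 4) * expR (- (q z / 2)) ^+ n.
  by rewrite -expRM_natl -expRD; congr expR; lra.
apply: (@le_trans _ _ (expR (n%:R * q z / 4) *
    \sum_(x : {ffun 'I_n -> Z}) \prod_i (q (x i) * h (x i)))).
  rewrite mulr_sumr; apply: ler_sum => x _; rewrite big_split/= mulrCA.
  apply: ler_wpM2l; first exact: prodr_ge0.
  rewrite -expR_sum -expRD; case: ltP => [lt|_]; last exact: expR_ge0.
  rewrite -[1%:R]expR0 ler_expR sumrN -natr_sum -sum1_card big_mkcond/= in lt *.
  by lra.
rewrite ler_pM2l ?expR_gt0//.
rewrite -(bigA_distr_bigA (fun=> fun y => q y * h y)) prodr_const card_ord.
apply: lerXn2r => //; rewrite nnegrE ?expR_ge0// sumr_ge0// => y _.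
by rewrite mulr_ge0// expR_ge0.
Qed.

(** * The good event *)

Section GoodEvent.
Variables (R : realType) (S A : finType) (rho : S -> R) (piref : S -> A -> R)
  (delta : R).
Hypotheses (rho_dist : is_dist rho) (piref_policy : is_policy piref)
  (delta01 : 0 < delta < 1).

Let SA_gt0 : 0 < (#|S| * #|A|)%:R :> R.
Proof.
rewrite ltr0n muln_gt0; apply/andP.
have cardS : (0 < #|S|)%N.
  rewrite lt0n; apply/eqP => S0; have := rho_dist.2; rewrite big_pred0 => [|s].
    by move/esym/eqP; rewrite oner_eq0.
  by have := card0_eq S0 s; rewrite inE.
split => //; case/card_gt0P: cardS => s _.
rewrite lt0n; apply/eqP => A0; have := (piref_policy s).2.
rewrite big_pred0 => [|a]; first by move/esym/eqP; rewrite oner_eq0.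
by have := card0_eq A0 a; rewrite inE.
Qed.

Definition log_factor : R := ln (2 * (#|S| * #|A|)%:R / delta).

Lemma expRN_log_factor : expR (- log_factor) = delta / (2 * (#|S| * #|A|)%:R).
Proof.
have [d0 _] := andP delta01.
rewrite /log_factor -lnV ?posrE ?divr_gt0 ?mulr_gt0// invf_div lnK//.
by rewrite posrE divr_gt0 ?mulr_gt0.
Qed.

Lemma log_factor_gt0 : 0 < log_factor.
Proof.
have [d0 d1] := andP delta01.
have SA1 : 1 <= (#|S| * #|A|)%:R :> R by rewrite ler1n -(ltr0n R).
by apply: ln_gt0; rewrite ltr_pdivlMr//; lra.
Qed.

Definition pair_dist (z : S * A) : R := rho z.1 * piref z.1 z.2.

Lemma pair_dist_ge0 z : 0 <= pair_dist z.
Proof. by rewrite mulr_ge0 ?rho_dist.1 ?(piref_policy _).1. Qed.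

Lemma sum_pair_dist : \sum_z pair_dist z = 1.
Proof.
rewrite -(pair_bigA _ (fun s a => rho s * piref s a))/= -rho_dist.2.
by apply: eq_bigr => s _; rewrite -mulr_sumr (piref_policy s).2 mulr1.
Qed.

Variables (n : nat) (d : measure_display) (T : measurableType d)
  (P : probability T R) (X : 'I_n -> T -> S * A) (E : 'I_n -> T -> R).
Hypothesis model : offline_data_model P rho piref X E.
Hypothesis n_large : forall z, rho z.1 != 0 -> 4 * log_factor <= n%:R * pair_dist z.

Let visits (x : 'I_n -> S * A) z := [pred i | x i == z].
Let radius x z : R := Num.sqrt (4 * log_factor / #|visits x z|%:R).

Let few x z : bool := (4 * #|visits x z|%:R < n%:R * pair_dist z)%R.

(** On a cylinder the counts are constants, so a low count spoils all of it; otherwise only a large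
    noise sum does. *)
Let bad (x : {ffun 'I_n -> S * A}) z : set T :=
  if rho z.1 == 0 then set0 else if few x z then cylinder X x else
  cylinder X x `&`
    [set w | #|visits x z|%:R * radius x z < `|\sum_(i in visits x z) E i w|].

Let mX i x : measurable (X i @^-1` [set x]).
Proof. exact: model.1. Qed.

Let Xq i z : P (X i @^-1` [set z]) = (pair_dist z)%:E.
Proof. by case: z => s a; rewrite model.2.1. Qed.

Let E_subg i : subgaussian1 P (E i).
Proof. exact: model.2.2.1. Qed.

Let XE_indep : mutually_independent P X E.
Proof. exact: model.2.2.2.2. Qed.

Let measurable_bad x z : measurable (bad x z).
Proof.
rewrite /bad; case: ifP => // _; case: ifP => _; first exact: measurable_cylinder.
apply: measurableI; first exact: measurable_cylinder.
apply: measurable_gt_set; apply: measurableT_comp => //.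
exact: measurable_sumE E_subg _.
Qed.

(** Both failure terms are kept in either case, so that summing over [x] separates them into a
    binomial tail and a total weight of 1. The radius makes the Chernoff exponent equal to
    [2 * log_factor]. *)
Let P_bad_le x z : (P (bad x z) <= (if rho z.1 == 0 then 0 else
  \prod_i pair_dist (x i) * (few x z)%:R +
  \prod_i pair_dist (x i) * (2 * expR (- (2 * log_factor))))%:E)%E.
Proof.
rewrite /bad; case: ifPn => [_|rs0]; first by rewrite measure0.
have prod0 : 0 <= \prod_i pair_dist (x i).
  by apply: prodr_ge0 => i _; exact: pair_dist_ge0.
have [_|notfew] := boolP (few x z).
  rewrite (P_cylinder mX Xq E_subg XE_indep) lee_fin mulr1 lerDl.
  by rewrite mulr_ge0// mulr_ge0// expR_ge0.
have L0 := log_factor_gt0.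
have N0 : 0 < #|visits x z|%:R :> R.
  by move: notfew; rewrite /few -leNgt; have := n_large rs0; lra.
apply: le_trans (tail_two_sided mX Xq E_subg XE_indep x _ (sqrtr_ge0 _)) _.
rewrite lee_fin mulr0 add0r sqr_sqrtr; last by rewrite divr_ge0// ltW// mulr_gt0.
have -> : #|visits x z|%:R * (4 * log_factor / #|visits x z|%:R) / 2 = 2 * log_factor.
  by field; rewrite gt_eqF.
by [].
Qed.

(** Union bound over covariate sequences and pairs, with a budget of [delta / (|S| |A|)] for each
    pair. *)
Lemma good_event : exists G : set T, measurable G /\ ((1 - delta)%:E <= P G)%E /\
  forall w, G w -> forall z, rho z.1 != 0 ->
    let I := [pred i | X i w == z] in
    n%:R * pair_dist z <= 4 * #|I|%:R /\
    `|\sum_(i in I) E i w| <= #|I|%:R * Num.sqrt (4 * log_factor / #|I|%:R).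
Proof.
have [d0 d1] := andP delta01.
pose Bad := \big[setU/set0]_x \big[setU/set0]_z bad x z.
have mBadx x : measurable (\big[setU/set0]_z bad x z).
  by apply: bigsetU_measurable => z _; exact: measurable_bad.
have mBad : measurable Bad.
  by apply: bigsetU_measurable => x _; exact: mBadx.
have PBad : (P Bad <= delta%:E)%E.
  apply: le_trans (measure_bigU_le P mBadx) _.
  apply: (@le_trans _ _ (\sum_(x : {ffun 'I_n -> S * A}) \sum_z
    (if rho z.1 == 0 then 0 else
      \prod_i pair_dist (x i) * (few x z)%:R +
      \prod_i pair_dist (x i) * (2 * expR (- (2 * log_factor))))%:E)%E).
    apply: lee_sum => x _; apply: le_trans (measure_bigU_le P _) _ => //.
    by apply: lee_sum => z _; exact: P_bad_le.
  rewrite exchange_big/=.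
  under eq_bigr do rewrite sumEFin.
  rewrite sumEFin lee_fin.
  have -> : delta = \sum_(z : S * A) delta / (#|S| * #|A|)%:R.
    by rewrite sumr_const card_prod -[RHS]mulr_natr divfK// gt_eqF.
  apply: ler_sum => z _; have [rs0|rs0] := boolP (rho z.1 == 0).
    by rewrite big1// divr_ge0// ltW.
  rewrite big_split/= -mulr_suml sum_prod_ffun_eq1 ?sum_pair_dist// mul1r.
  have tail := binomial_lower_tail n z pair_dist_ge0 sum_pair_dist.
  have {tail} := le_trans tail _; rewrite /few => /(_ (expR (- log_factor))).
  rewrite ler_expR => tail.
  have {}tail := tail ltac:(have := n_large rs0; lra).
  apply: le_trans (lerD tail (lexx _)) _.
  (* With [e = expR (- log_factor)], low counts cost [e] and the noise costs [2 e^2 <= e] since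
     [e <= 1/2]; the budget is [2 e]. *)
  have -> : expR (- (2 * log_factor)) = expR (- log_factor) ^+ 2.
    by rewrite -expRM_natl; congr expR; ring.
  rewrite expRN_log_factor; set m := (#|S| * #|A|)%:R.
  have m0 : 0 < m := SA_gt0.
  have -> : delta / m = 2 * (delta / (2 * m)) by rewrite invfM mulrCA mulVKf ?pnatr_eq0.
  set e := delta / (2 * m); have e0 : 0 < e by rewrite divr_gt0 ?mulr_gt0.
  have e1 : e <= 1 / 2.
    have m1 : 1 <= m by rewrite ler1n -(ltr0n R).
    by rewrite ler_pdivrMr ?mulr_gt0//; lra.
  nra.
exists (~` Bad); split; first exact: measurableC.
split; first by rewrite probability_setC// EFinB leeB.
(* The outcome [w] lies in the cylinder of its own covariates, where the counts of [x] are the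
   observed ones. *)
move=> w Gw z rs0 I; pose x := [ffun i => X i w].
have visitsE : visits x z =i I by move=> i; rewrite !inE ffunE.
have cardE : #|visits x z| = #|I| by exact: eq_card.
have sumE : \sum_(i in visits x z) E i w = \sum_(i in I) E i w by exact: eq_bigl.
have xw : cylinder X x w by move=> i _; rewrite /= ffunE.
have : ~ bad x z w.
  move=> bw; apply: Gw; rewrite /Bad (bigD1 x)//=; left.
  by rewrite (bigD1 z)//=; left.
rewrite /bad (negbTE rs0); case: ifPn => //.
rewrite /few cardE -leNgt => few_x out; split => //.
rewrite leNgt; apply/negP => lt; apply: out; split => //=.
by rewrite sumE /radius cardE.
Qed.

End GoodEvent.

(** * Error of the pessimistic reward *)

Section EmpiricalReward.
Variables (R : realType) (S A : finType) (d : measure_display)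
  (T : measurableType d) (n : nat)
  (X : 'I_n -> T -> S * A) (E : 'I_n -> T -> R) (r : S -> A -> R) (w : T)
  (s : S) (a : A).
Let I := [pred i | X i w == (s, a)].

Lemma count_dataset : Defs.count (dataset r X E w) s a = #|I|.
Proof. by apply: eq_card => i; rewrite !inE unfold_in; apply/asboolP/idP. Qed.

Lemma fbar_dataset : (0 < #|I|)%N ->
  fbar (dataset r X E w) s a - r s a = (\sum_(i in I) E i w) / #|I|%:R.
Proof.
move=> I0; rewrite /fbar count_dataset eqn0Ngt I0/=.
have -> : \sum_(i < n | X i w == (s, a)) (r (X i w).1 (X i w).2 + E i w) =
    #|I|%:R * r s a + \sum_(i in I) E i w.
  rewrite big_split/= (eq_bigr (fun=> r s a)) => [|i /eqP -> //].
  by rewrite sumr_const mulr_natl.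
by rewrite mulrDl mulrAC divff ?pnatr_eq0 -?lt0n// mul1r addrAC subrr add0r.
Qed.

Lemma fhat_error (delta : R) : (0 < #|I|)%N -> 0 <= log_factor S A delta ->
  `|\sum_(i in I) E i w| <=
    #|I|%:R * Num.sqrt (4 * log_factor S A delta / #|I|%:R) ->
  (fhat delta (dataset r X E w) s a - r s a) ^+ 2 <=
    16 * log_factor S A delta / #|I|%:R.
Proof.
move=> I0 L0 sumE; have N0 : 0 < #|I|%:R :> R by rewrite ltr0n.
rewrite /fhat addrAC fbar_dataset// /bonus count_dataset eqn0Ngt I0/=.
rewrite -/(log_factor S A delta); set b := Num.sqrt _.
have b2 : b ^+ 2 = 4 * log_factor S A delta / #|I|%:R.
  by rewrite sqr_sqrtr// divr_ge0 ?mulr_ge0// ltW.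
have b0 : 0 <= b := sqrtr_ge0 _.
have : `|(\sum_(i in I) E i w) / #|I|%:R| <= b.
  by rewrite normrM normfV (gtr0_norm N0) ler_pdivrMr// mulrC.
set y := _ / _; rewrite ler_norml => /andP[yl yr].
have -> : 16 * log_factor S A delta / #|I|%:R = 4 * b ^+ 2.
  by rewrite b2 !mulrA; congr (_ * _ / _); ring.
(* The error is [y - b] with [y] the noise average, and [4 b^2 - (y - b)^2 = (b + y) (3 b - y)]. *)
have := mulr_ge0 (_ : 0 <= b + y) (_ : 0 <= 3 * b - y).
by move=> /(_ ltac:(lra) ltac:(lra)); lra.
Qed.

End EmpiricalReward.

(** * From the good event to the sample size *)

Theorem theorem3p2 :
  exists (c k : nat),
  forall (R : realType) (S A : finType)
    (r : S -> A -> R) (rho : S -> R) (piref : S -> A -> R) (eta delta : R)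
    (pistar : S -> A -> R),
    (forall s a, 0 <= r s a <= 1) ->
    is_dist rho ->
    is_policy piref ->
    (forall s a, 0 < piref s a) ->
    0 < eta ->
    0 < delta < 1 ->
    is_maximizer rho piref eta r pistar ->
  exists eps0 : R, 0 < eps0 /\
  forall eps : R, 0 < eps -> eps < 1 -> eps < eps0 ->
  forall n : nat,
    c%:R * eta * (concentrability pistar piref) ^+ 2 * (#|S| * #|A|)%:R
      * (ln (2 * (#|S| * #|A|)%:R / delta)) ^+ k / eps <= n%:R ->
  forall (d : measure_display) (T : measurableType d) (P : probability T R)
    (X : 'I_n -> T -> S * A) (E : 'I_n -> T -> R) (pihat : T -> S -> A -> R),
    offline_data_model P rho piref X E ->
    (forall w, is_maximizer rho piref eta (fhat delta (dataset r X E w)) (pihat w)) ->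
  exists G : set T, measurable G /\ ((1 - delta)%:E <= P G)%E /\
    forall w, G w -> (SubOpt rho piref eta r pistar (pihat w) <= eps%:E)%E.
Proof.
(* [192 = 3 * 16 * 4]: 3 from the quadratic gap, 16 from the squared error [16 L / N], 4 from
   [N >= n q / 4]. One power of the logarithm suffices. *)
exists 192%N, 1%N.
move=> R S A r rho piref eta delta pistar _ rho_dist piref_policy piref0 eta0 delta01
  star_max.
have L0 := log_factor_gt0 rho_dist piref_policy delta01.
set L := log_factor S A delta in L0.
pose q s a := rho s * piref s a.
have q0 s a : rho s != 0 -> 0 < q s a.
  by move=> rs0; rewrite mulr_gt0// lt_neqAle eq_sym rs0 rho_dist.1.
(* Above the threshold [M], all counts are large and [pihat <= 2 pistar]. *)
pose M := \big[Num.max/1]_(t : S * A * A)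
  Num.max (4 * L / q t.1.1 t.1.2)
    (64 * L * (24 * eta) ^+ 2 / (q t.1.1 t.1.2 * piref t.1.1 t.2 ^+ 2)).
(* Starting the maximum at 1 makes [M], and later [n], positive. States of zero mass enter as
   divisions by zero, hence as 0. *)
have M1 : 1 <= M by exact: bigmax_ge_id.
have M_ge s a b : 4 * L / q s a <= M /\
    64 * L * (24 * eta) ^+ 2 / (q s a * piref s b ^+ 2) <= M.
  have := le_bigmax 1 (fun t : S * A * A => Num.max (4 * L / q t.1.1 t.1.2)
    (64 * L * (24 * eta) ^+ 2 / (q t.1.1 t.1.2 * piref t.1.1 t.2 ^+ 2))) (s, a, b).
  by rewrite -/M /= ge_max => /andP.
set C := concentrability pistar piref.
have [s0 rs0] : exists s, rho s != 0.
  apply/existsP; apply: contraT => /existsPn rho0.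
  have := rho_dist.2; rewrite big1 => [/esym/eqP|s _]; first by rewrite oner_eq0.
  exact/eqP/negbNE/rho0.
have [a0 _] : exists a : A, true.
  apply/existsP; apply: contraT => /existsPn noA.
  have := (piref_policy s0).2; rewrite big1 => [/esym/eqP|a _].
    by rewrite oner_eq0.
  by have := noA a.
have C0 : 0 < C.
  apply: lt_le_trans (le_bigmax 0 (fun sa : S * A =>
    pistar sa.1 sa.2 / piref sa.1 sa.2) (s0, a0)).
  apply: divr_gt0 => //.
  exact: (maximizer_gt0 rho_dist piref_policy piref0 eta0 star_max).
have SA0 : 0 < (#|S| * #|A|)%:R :> R.
  by rewrite ltr0n muln_gt0; apply/andP; split; apply/card_gt0P; [exists s0|exists a0].
pose K := 192 * eta * C ^+ 2 * (#|S| * #|A|)%:R * L.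
have K0 : 0 < K by rewrite !mulr_gt0// exprn_gt0.
(* Then [eps < K / M] and [n >= K / eps] force [n >= M]. *)
exists (K / M); split; first by rewrite divr_gt0//; lra.
move=> eps eps_gt0 _ eps_lt n; rewrite expr1 -/K => n_ge d T P X E pihat model hat_max.
have M0 : 0 < M by lra.
have nM : M <= n%:R.
  by apply: le_trans n_ge; rewrite ler_pdivlMr// mulrC -ler_pdivlMr// ltW.
have n0 : 0 < n%:R :> R by lra.
have n_large (z : S * A) : rho z.1 != 0 -> 4 * L <= n%:R * pair_dist rho piref z.
  move=> rz0; have [h _] := M_ge z.1 z.2 a0.
  by rewrite -ler_pdivrMr ?q0//; exact: le_trans nM.
have [G [mG [PG Gbound]]] := good_event rho_dist piref_policy delta01 model n_large.
exists G; split => //; split => // w Gw.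
have err s a : rho s != 0 ->
    (fhat delta (dataset r X E w) s a - r s a) ^+ 2 <= 64 * L / (n%:R * q s a).
  move=> rs; have [/= count_ge sum_le] := Gbound w Gw (s, a) rs.
  have qs := q0 s a rs; have nq : 0 < n%:R * q s a by rewrite mulr_gt0.
  have N0 : 0 < #|[pred i | X i w == (s, a)]|%:R :> R.
    by move: count_ge; rewrite /pair_dist/= -/(q s a); lra.
  apply: le_trans (fhat_error _ _ _ sum_le) _; [by rewrite -(ltr0n R)|exact: ltW|].
  rewrite ler_pdivrMr// -/L mulrAC ler_pdivlMr//.
  by move: count_ge; rewrite /pair_dist/= -/(q s a); nra.
apply: le_trans (SubOpt_le rho_dist piref_policy piref0 eta0 star_max (hat_max w)
  (K := 64 * L / n%:R) _ _ _) _.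
- by rewrite divr_ge0// mulr_ge0// ltW.
- move=> s a b rs; have [_] := M_ge s a b; have qs := q0 s a rs.
  have pb := piref0 s b.
  have qp : 0 < q s a * piref s b ^+ 2 by apply: mulr_gt0 => //; exact: exprn_gt0.
  have nq : 0 < n%:R * q s a by exact: mulr_gt0.
  rewrite (ler_pdivrMr _ _ qp) => hM.
  (* The closeness condition is checked on squares, where it becomes the second entry of [M] bounded
     by [n]. *)
  rewrite -(@ler_pXn2r _ 2) ?nnegrE ?mulr_ge0 ?(ltW pb) ?(ltW eta0)//.
  rewrite exprMn real_normK ?num_real//.
  apply: le_trans (ler_wpM2l (sqr_ge0 _) (err s a rs)) _.
  rewrite mulrA (ler_pdivrMr _ _ nq) mulrC.
  apply: le_trans hM _; rewrite [leRHS]mulrCA (mulrC (_ ^+ 2)).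
  by rewrite ler_wpM2r// ltW.
- move=> s a rs; have := err s a rs; have qs := q0 s a rs.
  have nq : 0 < n%:R * q s a by exact: mulr_gt0.
  by rewrite (ler_pdivlMr _ _ nq) => h; rewrite -/(q s a) ler_pdivlMr//; lra.
rewrite lee_fin -/C.
have -> : 3 * eta * C ^+ 2 * (#|S| * #|A|)%:R * (64 * L / n%:R) = K / n%:R.
  by rewrite /K; field; rewrite gt_eqF.
by rewrite ler_pdivrMr// mulrC -ler_pdivrMr.
Qed.
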